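(* Let $k\in\mathbb{N}$, $j\in\mathbb{N}$ with $j\ge k+1$, and $0<\theta\le\pi$. Write $\sigma=\sin\frac{\theta}{2}$ and $L=\ln\sigma$. Then \[ \begin{aligned} \mathrm{Ls}_j^{(k)}(\theta) &=(\ln2)^{j}\left(\frac{2\sigma}{\ln2}\right)^{k+1}\Biggl[k!\sum_{q=1}^{\infty}\frac{(-1)^{q+1}}{(k+2q)!}(2\sigma)^{2q}Q(k+1,2q;2) \sum_{\ell=0}^{j-k-1}\binom{j-k-1}{\ell}\frac{1}{(\ln 2)^{\ell}}\sum_{p=0}^{\ell}\frac{(-1)^p\langle\ell\rangle_{p}\,L^{\ell-p}}{(k+2q+1)^{p+1}}\\ &\qquad-\sum_{\ell=0}^{j-k-1}\binom{j-k-1}{\ell}\frac{1}{(\ln 2)^{\ell}}\sum_{p=0}^{\ell}\frac{(-1)^p\langle\ell\rangle_{p}\,L^{\ell-p}}{(k+1)^{p+1}}\Biggr], \end{aligned} \] with the convention $0^0=1$ (relevant when $\theta=\pi$, $L=0$).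
   Context: The generalized logsine function is $\mathrm{Ls}_j^{(k)}(\theta)=-\int_{0}^{\theta}x^k\left(\ln\left|2\sin\frac{x}{2}\right|\right)^{j-k-1}dx$ for integers $j\ge k+1\ge1$ and real $\theta$. The falling factorial is $\langle z\rangle_p=z(z-1)\cdots(z-p+1)$ for $p\in\mathbb{N}$, $\langle z\rangle_0=1$. $s(n,k)$ denotes the signed Stirling numbers of the first kind, defined by $\frac{[\ln(1+x)]^k}{k!}=\sum_{n=k}^\infty s(n,k)\frac{x^n}{n!}$ for $|x|<1$; equivalently $\prod_{j=0}^{n-1}(z-j)=\sum_{k=0}^n s(n,k)z^k$. For $m\in\mathbb{N}$, $k\in\mathbb{N}_0$ and $\alpha\in\mathbb{R}$ define \[ Q(m,k;\alpha)=\sum_{\ell=0}^{k}\binom{m+\ell-1}{m-1}\, s(m+k-1,m+\ell-1)\left(\frac{m+k-\alpha}{2}\right)^{\ell}, \] with the convention $0^0=1$. *)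

(* Defs.v *)
From Stdlib Require Import Reals Lra Lia Factorial.
From Coquelicot Require Import Coquelicot.
Open Scope R_scope.

Definition Ls (j k : nat) (theta : R) : R :=
  - RInt (fun x => x ^ k * (ln (Rabs (2 * sin (x / 2)))) ^ (j - k - 1)) 0 theta.

Fixpoint falling (z : R) (p : nat) : R :=
  match p with
  | O => 1
  | S p' => falling z p' * (z - INR p')
  end.

(* Signed Stirling numbers of the first kind:
   prod_{i<n} (z - i) = sum_k s(n,k) z^k, via the standard recurrence
   s(n+1,k+1) = s(n,k) - n s(n,k+1). *)
Fixpoint stirling1 (n k : nat) : R :=
  match n, k with
  | O, O => 1
  | O, S _ => 0
  | S _, O => 0
  | S n', S k' => stirling1 n' k' - INR n' * stirling1 n' (S k')
  end.

(* Q(m,k;alpha) = sum_{l=0}^k C(m+l-1, m-1) s(m+k-1, m+l-1) ((m+k-alpha)/2)^l  (pow: 0^0 = 1) *)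
Definition Qf (m k : nat) (alpha : R) : R :=
  sum_f_R0 (fun l => Binomial.C (m + l - 1) (m - 1) * stirling1 (m + k - 1) (m + l - 1)
                     * ((INR (m + k) - alpha) / 2) ^ l) k.

Definition ls_inner (j k : nat) (L : R) (r : nat) : R :=
  sum_f_R0 (fun l => Binomial.C (j - k - 1) l / (ln 2) ^ l *
     sum_f_R0 (fun p => (-1) ^ p * falling (INR l) p * L ^ (l - p) / (INR r) ^ (p + 1)) l)
    (j - k - 1).

Definition ls_term (j k : nat) (sigma : R) (q : nat) : R :=
  (-1) ^ (q + 1) / INR (fact (k + 2 * q)) * (2 * sigma) ^ (2 * q)
  * Qf (k + 1) (2 * q) 2 * ls_inner j k (ln sigma) (k + 2 * q + 1).

(* Main.v *)
(* Put s = sin(x/2).  The theorem is the termwise integral of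
     x^k = 2^k k! cos(x/2) sum_N a_N s^N
   against (ln(2s))^(j-k-1), where a_N are the Taylor coefficients at 0 of
   arcsin^k t / (k! sqrt(1 - t^2)).  Two facts on central factorials
   G_N(z) = prod_{i<N} (z + (N-1)/2 - i) give the coefficients: Q(k+1, 2q; 2) is
   the coefficient of z^k in G_(k+2q), and G_(N+2)(z) = (z^2 - ((N+1)/2)^2) G_N(z)
   is, up to a factor (-4)^q / N!, the recurrence satisfied by a_N.
   Termwise integration is justified up to theta = PI, where the series diverges
   at t = 1: since 0 <= a_N <= 1, the remainders lie between 0 and x^k on [0, PI]
   and tend to 0 geometrically on [0, c] for c < PI. *)
Require Import Defs.
From Stdlib Require Import Reals Factorial Lra Lia.
From Coquelicot Require Import Coquelicot.
Open Scope R_scope.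

(** * Central factorial coefficients *)

(** The coefficient recurrences below relate N + 2 to N. *)
Lemma nat_ind_2step (P : nat -> Prop) :
  P O -> P 1%nat -> (forall n, P n -> P (S (S n))) -> forall n, P n.
Proof.
  intros H0 H1 HS n.
  enough (P n /\ P (S n)) by tauto.
  induction n as [|n [IH1 IH2]]; auto.
Qed.

(* Taylor coefficients at 0 of arcsin^k t / (k! sqrt(1 - t^2)). *)
Fixpoint arcsin_coef (k N : nat) {struct N} : R :=
  match N with
  | O => match k with O => 1 | _ => 0 end
  | S O => match k with 1%nat => 1 | _ => 0 end
  | S (S M) =>
      (INR (S M) ^ 2 * arcsin_coef k M
       + match k with S (S k') => arcsin_coef k' M | _ => 0 end)
      / (INR (S M) * INR (S (S M)))
  end.

Lemma arcsin_coef_SS (k M : nat) :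
  arcsin_coef k (S (S M)) =
  (INR (S M) ^ 2 * arcsin_coef k M
   + match k with S (S k') => arcsin_coef k' M | _ => 0 end)
  / (INR (S M) * INR (S (S M))).
Proof. reflexivity. Qed.

(** With m = M + 1 the numerator is at most m^2 + 1, and m^2 + 1 <= m (m + 1) because m >= 1. These
    bounds make the later tail estimates geometric. *)
Lemma arcsin_coef_bounds (N k : nat) : 0 <= arcsin_coef k N <= 1.
Proof.
  revert k; induction N as [| |M IH] using nat_ind_2step; intros k.
  - destruct k; simpl; lra.
  - destruct k as [|[|k]]; simpl; lra.
  - rewrite arcsin_coef_SS.
    assert (HM : 1 <= INR (S M)) by (rewrite S_INR; pose proof (pos_INR M); lra).
    rewrite (S_INR (S M)).
    pose proof (IH k) as Hk.
    assert (H2 : 0 <= match k with S (S k') => arcsin_coef k' M | _ => 0 end <= 1)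
      by (destruct k as [|[|k']]; [lra | lra | apply IH]).
    revert H2; generalize (match k with S (S k') => arcsin_coef k' M | _ => 0 end).
    intros b Hb.
    split.
    + apply Rdiv_le_0_compat; nra.
    + apply Rle_div_l; nra.
Qed.

Lemma arcsin_coef_lt (N k : nat) : (N < k)%nat -> arcsin_coef k N = 0.
Proof.
  revert k; induction N as [| |M IH] using nat_ind_2step; intros k Hk.
  - destruct k; [lia | reflexivity].
  - destruct k as [|[|k]]; [lia | lia | reflexivity].
  - rewrite arcsin_coef_SS, IH by lia.
    destruct k as [|[|k]]; [lia | lia |].
    rewrite IH by lia. unfold Rdiv; ring.
Qed.

(** The generating function has the parity of k. The index is given by an equation so that the
    two-step induction on N can lower either k by 2 or q by 1. *)
Lemma arcsin_coef_odd (N k q : nat) :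
  N = (k + 2 * q + 1)%nat -> arcsin_coef k N = 0.
Proof.
  revert k q; induction N as [| |M IH] using nat_ind_2step; intros k q Hk.
  - lia.
  - destruct k as [|[|k]]; [reflexivity | lia | reflexivity].
  - rewrite arcsin_coef_SS.
    assert (H1 : arcsin_coef k M = 0).
    { destruct q; [apply arcsin_coef_lt; lia | apply (IH k q); lia]. }
    rewrite H1.
    destruct k as [|[|k]]; [unfold Rdiv; ring | unfold Rdiv; ring |].
    rewrite (IH k q) by lia. unfold Rdiv; ring.
Qed.

(* Coefficient of z^k in (z + x)(z + x - 1) ... (z + x - N + 1). *)
Fixpoint shifted_falling_coef (N k : nat) (x : R) : R :=
  match N with
  | O => match k with O => 1 | _ => 0 end
  | S N' =>
      match k with O => 0 | S k' => shifted_falling_coef N' k' x end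
      + (x - INR N') * shifted_falling_coef N' k x
  end.

Lemma shifted_falling_coef_lt (N k : nat) (x : R) :
  (N < k)%nat -> shifted_falling_coef N k x = 0.
Proof.
  revert k; induction N as [|N IH]; intros k Hk; destruct k; try lia.
  - reflexivity.
  - simpl. rewrite !IH by lia. ring.
Qed.

(* Peels off the first factor of the product instead of the last one. *)
Lemma shifted_falling_coef_shift (N k : nat) (x : R) :
  shifted_falling_coef (S N) k (x + 1) =
  match k with O => 0 | S k' => shifted_falling_coef N k' x end
  + (x + 1) * shifted_falling_coef N k x.
Proof.
  revert k; induction N as [|N IH]; intros k.
  - destruct k as [|[|k]]; simpl; ring.
  - change (shifted_falling_coef (S (S N)) k (x + 1)) with
      (match k with O => 0 | S k' => shifted_falling_coef (S N) k' (x + 1) end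
       + (x + 1 - INR (S N)) * shifted_falling_coef (S N) k (x + 1)).
    rewrite IH, S_INR.
    destruct k as [|k].
    + change (shifted_falling_coef (S N) 0 x) with
        (0 + (x - INR N) * shifted_falling_coef N 0 x). ring.
    + rewrite IH.
      change (shifted_falling_coef (S N) (S k) x) with
        (shifted_falling_coef N k x
         + (x - INR N) * shifted_falling_coef N (S k) x).
      change (shifted_falling_coef (S N) k x) with
        (match k with O => 0 | S k' => shifted_falling_coef N k' x end
         + (x - INR N) * shifted_falling_coef N k x).
      ring.
Qed.

(** Passing from N to N + 2 raises x by 1 and adds one factor at each end of the product, z + (x +
    1) and z - (x + 1); together they give z^2 - ((N + 1) / 2)^2. *)
Lemma central_coef_recurrence (N k : nat) :
  shifted_falling_coef (S (S N)) k ((INR (S (S N)) - 1) / 2) =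
  match k with S (S k') => shifted_falling_coef N k' ((INR N - 1) / 2) | _ => 0 end
  - (INR (S N) / 2) ^ 2 * shifted_falling_coef N k ((INR N - 1) / 2).
Proof.
  set (x := (INR N - 1) / 2).
  replace ((INR (S (S N)) - 1) / 2) with (x + 1)
    by (unfold x; rewrite !S_INR; field).
  change (shifted_falling_coef (S (S N)) k (x + 1)) with
    (match k with O => 0 | S k' => shifted_falling_coef (S N) k' (x + 1) end
     + (x + 1 - INR (S N)) * shifted_falling_coef (S N) k (x + 1)).
  assert (HN : INR (S N) = 2 * (x + 1)) by (unfold x; rewrite S_INR; field).
  rewrite HN.
  destruct k as [|[|k]]; rewrite !shifted_falling_coef_shift; field.
Qed.

(** Up to the factor (-1/4)^q N! both sides obey the same recurrence: lowering k by 2 keeps q, while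
    keeping k lowers q by 1. *)
Lemma central_coef_arcsin_coef (N k q : nat) :
  N = (k + 2 * q)%nat ->
  shifted_falling_coef N k ((INR N - 1) / 2) =
  (- / 4) ^ q * INR (fact N) * arcsin_coef k N.
Proof.
  revert k q; induction N as [| |M IH] using nat_ind_2step; intros k q Hk.
  - assert (k = O) by lia; assert (q = O) by lia; subst; simpl; ring.
  - assert (k = 1%nat) by lia; assert (q = O) by lia; subst; simpl; ring.
  - rewrite central_coef_recurrence, arcsin_coef_SS, !fact_simpl, !mult_INR.
    (* The factor -1/4 on the left avoids the exponent q - 1; for q = 0 both sides vanish, since M <
       k. *)
    assert (H1 : shifted_falling_coef M k ((INR M - 1) / 2) * (- / 4)
                 = (- / 4) ^ q * INR (fact M) * arcsin_coef k M).
    { destruct q as [|q].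
      - rewrite shifted_falling_coef_lt, arcsin_coef_lt by lia. ring.
      - rewrite (IH k q) by lia. simpl. ring. }
    assert (H2 : match k with
                 | S (S k') => shifted_falling_coef M k' ((INR M - 1) / 2)
                 | _ => 0 end
                 = (- / 4) ^ q * INR (fact M) *
                   match k with S (S k') => arcsin_coef k' M | _ => 0 end).
    { destruct k as [|[|k]]; [ring | ring |].
      apply IH; lia. }
    rewrite H2.
    assert (HM : 0 < INR (S M)) by apply lt_0_INR, Nat.lt_0_succ.
    assert (HM' : 0 < INR (S (S M))) by apply lt_0_INR, Nat.lt_0_succ.
    transitivity ((- / 4) ^ q * INR (fact M) *
       (INR (S M) ^ 2 * arcsin_coef k M +
        match k with S (S k') => arcsin_coef k' M | _ => 0 end)).
    + transitivity ((- / 4) ^ q * INR (fact M) *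
        match k with S (S k') => arcsin_coef k' M | _ => 0 end
        + INR (S M) ^ 2 * (shifted_falling_coef M k ((INR M - 1) / 2) * (- / 4)));
        [field | rewrite H1; ring].
    + field. lra.
Qed.

(** * Stirling numbers and the values Q(k+1, 2q; 2) *)

Lemma stirling1_lt (n k : nat) : (n < k)%nat -> stirling1 n k = 0.
Proof.
  revert k; induction n as [|n IH]; intros k Hk; destruct k; try lia.
  - reflexivity.
  - simpl. rewrite !IH by lia. ring.
Qed.

Lemma C_diag (n : nat) : Binomial.C n n = 1.
Proof.
  unfold Binomial.C. rewrite Nat.sub_diag. simpl. field. apply INR_fact_neq_0.
Qed.

Lemma C_0_r (n : nat) : Binomial.C n 0 = 1.
Proof.
  unfold Binomial.C. rewrite Nat.sub_0_r. simpl. field. apply INR_fact_neq_0.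
Qed.

(** The sum is the k-th Taylor coefficient at x of z(z-1)...(z-N+1), that is, the coefficient of z^k
    after replacing z by z + x. Any cutoff M with N <= k + M captures all nonzero Stirling
    numbers. *)
Lemma stirling1_taylor_shift (N k M : nat) (x : R) :
  (N <= k + M)%nat ->
  sum_f_R0 (fun l => Binomial.C (k + l) k * stirling1 N (k + l) * x ^ l) M
  = shifted_falling_coef N k x.
Proof.
  revert k M; induction N as [|N IH]; intros k M HM.
  - destruct M as [|M].
    + simpl. rewrite Nat.add_0_r, C_diag. destruct k; simpl; ring.
    + rewrite decomp_sum by lia. rewrite Nat.add_0_r, C_diag. simpl pred.
      rewrite (sum_eq _ (fun _ => 0)).
      * rewrite sum_cte. destruct k; simpl; ring.
      * intros i _. rewrite stirling1_lt by lia. ring.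
  (* By Pascal's rule the part with s(N, k+l-1) splits into two sums: [Hx] lowers l and yields the
     factor x, [Hk] lowers k and yields the factor z. *)
  - assert (Hx : sum_f_R0 (fun l => match l with
                   | O => 0
                   | S l' => Binomial.C (k + l') k * stirling1 N (k + l') * x ^ l end) M
                 = x * shifted_falling_coef N k x).
    { destruct M as [|M].
      - simpl. rewrite shifted_falling_coef_lt by lia. ring.
      - rewrite decomp_sum by lia. simpl pred. rewrite Rplus_0_l.
        rewrite <- (IH k M) by lia. rewrite scal_sum.
        apply sum_eq. intros i _. simpl. ring. }
    assert (Hk : sum_f_R0 (fun l => match k with
                   | O => 0
                   | S k' => Binomial.C (k' + l) k' * stirling1 N (k' + l) * x ^ l end) M
                 = match k with O => 0 | S k' => shifted_falling_coef N k' x end).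
    { destruct k as [|k]; [rewrite sum_cte; ring | apply IH; lia]. }
    simpl shifted_falling_coef. rewrite Rmult_minus_distr_r.
    rewrite <- Hk, <- Hx, <- (IH k M) by lia.
    rewrite scal_sum, <- minus_sum, <- plus_sum.
    apply sum_eq. intros l _.
    destruct k as [|k]; destruct l as [|l].
    + assert (INR N * stirling1 N 0 = 0) by (destruct N; simpl; ring).
      simpl (0 + 0)%nat. rewrite C_0_r. simpl (stirling1 (S N) 0). simpl (x ^ 0). lra.
    + simpl (0 + S l)%nat. rewrite !C_0_r. simpl. ring.
    + rewrite !Nat.add_0_r, !C_diag. simpl. ring.
    + replace (S k + S l)%nat with (S (k + S l)) by lia.
      rewrite <- pascal by lia.
      replace (S k + l)%nat with (k + S l)%nat by lia.
      simpl stirling1. ring.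
Qed.

(** With m = k + 1 and alpha = 2 the base (m + 2q - alpha) / 2 equals (N - 1) / 2 for N = k + 2q,
    exactly the shift that makes the falling factorial central. *)
Lemma Qf_arcsin_coef (k q : nat) :
  Qf (k + 1) (2 * q) 2 =
  (- / 4) ^ q * INR (fact (k + 2 * q)) * arcsin_coef k (k + 2 * q).
Proof.
  rewrite <- central_coef_arcsin_coef by reflexivity.
  rewrite <- (stirling1_taylor_shift _ _ (2 * q)) by lia.
  unfold Qf. apply sum_eq. intros l _.
  replace (k + 1 + l - 1)%nat with (k + l)%nat by lia.
  replace (k + 1 - 1)%nat with k by lia.
  replace (k + 1 + 2 * q - 1)%nat with (k + 2 * q)%nat by lia.
  replace (k + 1 + 2 * q)%nat with (S (k + 2 * q)) by lia.
  rewrite S_INR. do 2 f_equal. field.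
Qed.

(** * Powers of arcsin as power series *)

Lemma CV_radius_gt_of_bounded_1 (a : nat -> R) (t : R) :
  (forall n, 0 <= a n <= 1) -> Rabs t < 1 -> Rbar_lt (Rabs t) (CV_radius a).
Proof.
  intros Ha Ht.
  apply Rbar_lt_le_trans with (Finite 1); [exact Ht |].
  apply (proj1 (CV_radius_bounded a)).
  exists 1; intros n. rewrite pow1, Rmult_1_r, Rabs_pos_eq; apply Ha.
Qed.

(* If y = sum_N a_k(N) t^N then (1 - t^2) y' - t y has these coefficients. *)
Definition arcsin_pow_coef (k N : nat) : R :=
  match N with
  | O => match k with 1%nat => 1 | _ => 0 end
  | S M => match k with S (S k') => arcsin_coef k' M / INR (S M) | _ => 0 end
  end.

Lemma arcsin_pow_coef_bounds (k N : nat) : 0 <= arcsin_pow_coef k N <= 1.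
Proof.
  destruct N as [|N]; destruct k as [|[|k]]; unfold arcsin_pow_coef; try lra.
  pose proof (arcsin_coef_bounds N k).
  assert (1 <= INR (S N)) by (rewrite S_INR; pose proof (pos_INR N); lra).
  split.
  - apply Rdiv_le_0_compat; lra.
  - apply Rle_div_l; lra.
Qed.

(** For n >= 1 the coefficient of t^n on the left is (n + 1) a(n+1) - n a(n-1), so the equation
    restates the recurrence of [arcsin_coef]. For k >= 1 the right side is the series of
    arcsin^(k-1) t / (k-1)!. *)
Lemma arcsin_series_ode (k : nat) (t : R) :
  Rabs t < 1 ->
  (1 - t ^ 2) * PSeries (PS_derive (arcsin_coef k)) t - t * PSeries (arcsin_coef k) t
  = PSeries (arcsin_pow_coef k) t.
Proof.
  intros Ht. symmetry. apply is_pseries_unique.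
  assert (Hr := CV_radius_gt_of_bounded_1 _ t (fun n => arcsin_coef_bounds n k) Ht).
  assert (H0 := PSeries_correct _ _ (CV_radius_inside _ _ Hr)).
  assert (H1 := PSeries_correct _ _ (ex_pseries_derive _ _ Hr)).
  assert (H2 := is_pseries_incr_1 _ _ _ (is_pseries_incr_1 _ _ _ H1)).
  assert (H3 := is_pseries_incr_1 _ _ _ H0).
  assert (H := is_pseries_minus _ _ _ _ _ (is_pseries_minus _ _ _ _ _ H1 H2) H3).
  match type of H with is_pseries _ _ ?l => replace (_ - _) with l end;
    [| unfold plus, opp, scal; simpl; unfold mult; simpl; ring].
  refine (is_pseries_ext _ _ _ _ _ H).
  intros n. unfold PS_minus, PS_plus, PS_opp, PS_incr_1, PS_derive.
  unfold plus, opp; simpl plus; simpl opp.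
  destruct n as [|[|n]].
  - unfold zero; simpl. destruct k as [|[|k]]; ring.
  - unfold zero; simpl. destruct k as [|[|k]]; field.
  - rewrite arcsin_coef_SS. simpl arcsin_pow_coef.
    assert (H4 : INR (S (S n)) <> 0) by (apply not_0_INR; lia).
    assert (H5 : INR (S (S (S n))) <> 0) by (apply not_0_INR; lia).
    rewrite (S_INR (S n)) in *.
    destruct k as [|[|k]]; simpl; field; split; assumption.
Qed.

(** * The substitution t = sin x *)

Lemma Rabs_sin_lt_1 (x : R) : - (PI / 2) < x < PI / 2 -> Rabs (sin x) < 1.
Proof.
  intros Hx. pose proof (cos_gt_0 x (proj1 Hx) (proj2 Hx)).
  pose proof (sin2_cos2 x). unfold Rsqr in *.
  apply Rabs_def1; nra.
Qed.

Lemma is_derive_PSeries_sin (a : nat -> R) (x : R) :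
  (forall n, 0 <= a n <= 1) -> - (PI / 2) < x < PI / 2 ->
  is_derive (fun x => PSeries a (sin x)) x (cos x * PSeries (PS_derive a) (sin x)).
Proof.
  intros Ha Hx.
  apply (is_derive_comp (PSeries a) sin).
  - apply is_derive_PSeries, CV_radius_gt_of_bounded_1, Rabs_sin_lt_1; assumption.
  - apply is_derive_Reals, derivable_pt_lim_sin.
Qed.

Lemma eq_of_is_derive (f g h : R -> R) (b x : R) :
  (forall y, - b < y < b -> is_derive f y (h y)) ->
  (forall y, - b < y < b -> is_derive g y (h y)) ->
  f 0 = g 0 -> - b < x < b -> f x = g x.
Proof.
  intros Hf Hg H0 Hx.
  assert (Hfg : forall y, - b < y < b -> is_derive (fun z => f z - g z) y 0).
  { intros y Hy. replace 0 with (h y - h y) by ring.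
    apply (is_derive_minus f g y _ _ (Hf y Hy) (Hg y Hy)). }
  destruct (Rtotal_order x 0) as [H | [-> | H]]; [| assumption |].
  - enough (f x - g x = f 0 - g 0) by lra.
    apply (eq_is_derive (fun z => f z - g z)); [| assumption].
    intros t Ht. apply Hfg; lra.
  - enough (f 0 - g 0 = f x - g x) by lra.
    apply (eq_is_derive (fun z => f z - g z)); [| assumption].
    intros t Ht. apply Hfg; lra.
Qed.

Lemma is_derive_pow_fact (k : nat) (x : R) :
  is_derive (fun x => x ^ S k / INR (fact (S k))) x (x ^ k / INR (fact k)).
Proof.
  replace (x ^ k / INR (fact k)) with (INR (S k) * x ^ k / INR (fact (S k))).
  - generalize (INR (fact (S k))). intros c.
    apply is_derive_Reals, derivable_pt_lim_div_scal, derivable_pt_lim_pow.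
  - rewrite fact_simpl, mult_INR.
    field. split; [apply INR_fact_neq_0 | apply not_0_INR; lia].
Qed.

Lemma PSeries_const (a : nat -> R) (t : R) :
  (forall n, a (S n) = 0) -> PSeries a t = a O.
Proof.
  intros Ha. apply is_pseries_unique, is_pseries_R.
  apply (filterlim_ext (fun _ => a O)); [| apply filterlim_const].
  intros n. rewrite sum_n_Reals. induction n as [|n IH]; simpl.
  - ring.
  - rewrite <- IH, Ha. ring.
Qed.

(** For t = sin x the product and chain rules give (1 - t^2) y'(t) - t y(t), the left side of
    [arcsin_series_ode]. *)
Lemma is_derive_cos_mul_arcsin_series (k : nat) (x : R) :
  - (PI / 2) < x < PI / 2 ->
  is_derive (fun x => cos x * PSeries (arcsin_coef k) (sin x)) x
    (PSeries (arcsin_pow_coef k) (sin x)).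
Proof.
  intros Hx.
  rewrite <- arcsin_series_ode by (apply Rabs_sin_lt_1, Hx).
  assert (H := is_derive_PSeries_sin _ x (fun n => arcsin_coef_bounds n k) Hx).
  assert (Hc : is_derive cos x (- sin x)) by apply is_derive_Reals, derivable_pt_lim_cos.
  assert (Hm := is_derive_mult cos _ x _ _ Hc H Rmult_comm).
  refine (eq_rect _ (is_derive _ x) Hm _ _).
  pose proof (sin2_cos2 x) as Hsc. unfold Rsqr in Hsc.
  unfold plus, mult; simpl.
  replace (1 - sin x * (sin x * 1)) with (cos x * cos x) by lra. ring.
Qed.

(* Both sides satisfy Y'' = (the same function for k - 2) in x. *)
Lemma cos_mul_arcsin_series (k : nat) (x : R) :
  - (PI / 2) < x < PI / 2 ->
  cos x * PSeries (arcsin_coef k) (sin x) = x ^ k / INR (fact k).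
Proof.
  pose proof PI2_1 as Hpi.
  revert x; induction k as [| |k IH] using nat_ind_2step; intros x Hx.
  - transitivity (1 : R); [| simpl; field].
    apply (eq_of_is_derive (fun x => cos x * PSeries (arcsin_coef 0) (sin x))
      (fun _ => 1) (fun _ => 0) (PI / 2)); [| | | assumption].
    + intros y Hy.
      replace 0 with (PSeries (arcsin_pow_coef 0) (sin y));
        [apply is_derive_cos_mul_arcsin_series, Hy |].
      apply PSeries_const. reflexivity.
    + intros y _. apply is_derive_Reals, derivable_pt_lim_const.
    + rewrite cos_0, sin_0, PSeries_0. simpl. ring.
  - apply (eq_of_is_derive (fun x => cos x * PSeries (arcsin_coef 1) (sin x))
      (fun x => x ^ 1 / INR (fact 1)) (fun x => x ^ 0 / INR (fact 0)) (PI / 2));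
      [| | | assumption].
    + intros y Hy.
      replace (y ^ 0 / INR (fact 0)) with (PSeries (arcsin_pow_coef 1) (sin y));
        [apply is_derive_cos_mul_arcsin_series, Hy |].
      rewrite PSeries_const by reflexivity. simpl. field.
    + intros y _. apply is_derive_pow_fact.
    + rewrite cos_0, sin_0, PSeries_0. simpl. field.
  - apply (eq_of_is_derive (fun x => cos x * PSeries (arcsin_coef (S (S k))) (sin x))
      (fun x => x ^ S (S k) / INR (fact (S (S k)))) 
      (fun x => x ^ S k / INR (fact (S k))) (PI / 2)); [| | | assumption].
    + intros y Hy.
      replace (y ^ S k / INR (fact (S k))) with (PSeries (arcsin_pow_coef (S (S k))) (sin y));
        [apply is_derive_cos_mul_arcsin_series, Hy |].
      (* Second differentiation: the termwise derivative of this series has the coefficients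
         [arcsin_coef k], so the chain rule produces the left side of the induction hypothesis. *)
      apply (eq_of_is_derive (fun x => PSeries (arcsin_pow_coef (S (S k))) (sin x))
        (fun x => x ^ S k / INR (fact (S k)))
        (fun x => x ^ k / INR (fact k)) (PI / 2)); [| | | assumption].
      * intros z Hz. rewrite <- IH by assumption.
        rewrite <- (PSeries_ext (PS_derive (arcsin_pow_coef (S (S k))))).
        -- apply is_derive_PSeries_sin; [| assumption].
           intros n; apply arcsin_pow_coef_bounds.
        -- intros n. unfold PS_derive. 
           change (arcsin_pow_coef (S (S k)) (S n)) with (arcsin_coef k n / INR (S n)).
           field. apply not_0_INR; lia.
      * intros z _. apply is_derive_pow_fact.
      * rewrite sin_0, PSeries_0. simpl arcsin_pow_coef. 
        rewrite pow_i by lia. unfold Rdiv; ring.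
    + intros y _. apply is_derive_pow_fact.
    + rewrite cos_0, sin_0, PSeries_0. simpl arcsin_coef. 
      rewrite pow_i by lia. unfold Rdiv; ring.
Qed.

(** Coefficients in [0, 1] and t >= 0 put the tail between 0 and the tail of the geometric
    series. *)
Lemma PSeries_tail_bounds (a : nat -> R) (t : R) (M : nat) :
  (forall n, 0 <= a n <= 1) -> 0 <= t < 1 ->
  0 <= PSeries a t - sum_f_R0 (fun n => a n * t ^ n) M <= t ^ S M / (1 - t).
Proof.
  intros Ha Ht.
  assert (Hex : ex_series (fun n => a n * t ^ n)).
  { destruct (CV_radius_inside a t) as [l Hl].
    - apply CV_radius_gt_of_bounded_1; [assumption | rewrite Rabs_pos_eq; lra].
    - exists l. apply is_pseries_R, Hl. }
  assert (Hg : is_series (fun n => t ^ S M * t ^ n) (t ^ S M / (1 - t))).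
  { apply (is_series_scal (t ^ S M) (fun n => t ^ n)), is_series_geom.
    rewrite Rabs_pos_eq; lra. }
  unfold PSeries. rewrite (Series_incr_n _ (S M)) by (lia || assumption).
  simpl pred.
  assert (Hterm : forall n, 0 <= a (S M + n)%nat * t ^ (S M + n) <= t ^ S M * t ^ n).
  { intros n. rewrite pow_add. pose proof (pow_le t (S M) (proj1 Ht)).
    pose proof (pow_le t n (proj1 Ht)). pose proof (Ha (S M + n)%nat).
    assert (0 <= t ^ S M * t ^ n) by (apply Rmult_le_pos; assumption).
    nra. }
  assert (H1 := Series_le (fun n => a (S M + n)%nat * t ^ (S M + n)) _ Hterm
            (ex_intro _ _ Hg)).
  rewrite (is_series_unique _ _ Hg) in H1.
  assert (H2 : 0 <= Series (fun n => a (S M + n)%nat * t ^ (S M + n))).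
  (* Here 0 is written as the sum of a zero series so that series can be compared termwise. *)
  { rewrite <- (Rmult_0_l (Series (fun _ => 0))), <- (Series_scal_l 0 (fun _ => 0)).
    apply Series_le.
    - intros n. rewrite Rmult_0_l. split; [lra | apply Hterm].
    - apply (proj1 (ex_series_incr_n (fun n => a n * t ^ n) (S M))), Hex. }
  lra.
Qed.

(** * Logarithmic integrals *)

(** Divided by m!, the left side is one term of a Taylor sum of exp u, all of whose terms are
    nonnegative. *)
Lemma pow_le_fact_mul_exp (u : R) (m : nat) :
  0 <= u -> u ^ m <= INR (fact m) * exp u.
Proof.
  intros Hu.
  assert (Hf : 0 < INR (fact m)) by apply INR_fact_lt_0.
  enough (u ^ m / INR (fact m) <= exp u) by (apply Rle_div_l in H; lra).
  apply Rle_trans with (2 := exp_ge_taylor u m Hu).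
  destruct m as [|m]; [simpl; lra |].
  change (sum_f_R0 (fun k => u ^ k / INR (fact k)) (S m)) with
    (sum_f_R0 (fun k => u ^ k / INR (fact k)) m + u ^ S m / INR (fact (S m))).
  enough (0 <= sum_f_R0 (fun k => u ^ k / INR (fact k)) m) by lra.
  apply cond_pos_sum. intros n.
  apply Rdiv_le_0_compat; [apply pow_le, Hu | apply INR_fact_lt_0].
Qed.

(* With u = - ln (sqrt x), the bound u^m <= m! e^u controls one of the two factors
   sqrt x of x. *)
Lemma mul_ln_pow_le_sqrt (x : R) (m : nat) :
  0 < x <= 1 -> Rabs (x * ln x ^ m) <= 2 ^ m * INR (fact m) * sqrt x.
Proof.
  intros [Hx Hx1].
  assert (Hs : 0 < sqrt x) by (apply sqrt_lt_R0, Hx).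
  assert (Hss : sqrt x * sqrt x = x) by (apply sqrt_sqrt; lra).
  assert (Hln : ln x = 2 * ln (sqrt x)) by (rewrite <- Hss at 1; rewrite ln_mult; lra).
  assert (Hneg : ln x <= 0).
  { rewrite <- ln_1. destruct Hx1 as [Hx1 | ->]; [left; apply ln_increasing; lra | lra]. }
  assert (Hb := pow_le_fact_mul_exp (- ln (sqrt x)) m ltac:(lra)).
  rewrite exp_Ropp, exp_ln in Hb by assumption.
  assert (Hb' : (- ln (sqrt x)) ^ m * sqrt x <= INR (fact m)).
  { apply Rmult_le_compat_r with (r := sqrt x) in Hb; [| lra].
    replace (INR (fact m) * / sqrt x * sqrt x) with (INR (fact m)) in Hb by (field; lra).
    exact Hb. }
  rewrite Rabs_mult, <- RPow_abs, (Rabs_pos_eq x), (Rabs_left1 (ln x)) by lra.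
  replace (- ln x) with (2 * - ln (sqrt x)) by lra.
  rewrite Rpow_mult_distr. rewrite <- Hss at 1.
  assert (0 < 2 ^ m) by (apply pow_lt; lra).
  assert (0 < 2 ^ m * sqrt x) by nra.
  nra.
Qed.

(** * Continuity in the presence of logarithms *)

Lemma continuous_pow (f : R -> R) (n : nat) (x : R) :
  continuous f x -> continuous (fun y => f y ^ n) x.
Proof.
  intros Hf. induction n as [|n IH]; simpl.
  - apply continuous_const.
  - apply (continuous_mult f (fun y => f y ^ n)); assumption.
Qed.

Lemma continuous_Rmult_const_l (c : R) (f : R -> R) (x : R) :
  continuous f x -> continuous (fun y => c * f y) x.
Proof. intros Hf. apply (continuous_scal_r c f), Hf. Qed.

Lemma is_derive_ln_Rabs (x : R) : 0 < x -> is_derive (fun y => ln (Rabs y)) x (/ x).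
Proof.
  intros Hx.
  apply (is_derive_ext_loc ln).
  - assert (H : locally x (fun y => 0 < y)) by (apply open_gt, Hx).
    apply filter_imp with (2 := H). intros y Hy. rewrite Rabs_pos_eq; lra.
  - apply is_derive_Reals, derivable_pt_lim_ln, Hx.
Qed.

Lemma continuous_ln_Rabs (x : R) : x <> 0 -> continuous (fun y => ln (Rabs y)) x.
Proof.
  intros Hx. apply (continuous_comp Rabs ln).
  - apply continuous_Rabs.
  - apply (ex_derive_continuous ln). eexists.
    apply is_derive_Reals, derivable_pt_lim_ln, Rabs_pos_lt, Hx.
Qed.

Lemma filterlim_of_Rabs_le (F : (R -> Prop) -> Prop) {FF : Filter F} (f g : R -> R) :
  F (fun x => Rabs (f x) <= g x) -> filterlim g F (locally 0) -> filterlim f F (locally 0).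
Proof.
  intros Hle Hg.
  apply (filterlim_le_le (fun x => - g x) f g 0).
  - apply filter_imp with (2 := Hle). intros x Hx. apply Rabs_le_between, Hx.
  - change (filterlim (fun x => - g x) F (locally 0)).
    rewrite <- Ropp_0.
    apply (filterlim_comp _ _ _ g Ropp F (locally 0)); [exact Hg |].
    apply (filterlim_opp (0 : R_NormedModule)).
  - exact Hg.
Qed.

(** Away from 0 both factors are continuous. At 0 the value is 0 whatever [ln 0] is, and the bound
    by a multiple of sqrt |y| squeezes the function to 0. *)
Lemma continuous_mul_ln_pow (m : nat) (x : R) :
  continuous (fun y => y * ln (Rabs y) ^ m) x.
Proof.
  destruct (Req_dec x 0) as [-> | Hx].
  - unfold continuous. rewrite Rmult_0_l.
    apply (filterlim_of_Rabs_le _ _ (fun y => 2 ^ m * INR (fact m) * sqrt (Rabs y))).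
    + exists (mkposreal 1 Rlt_0_1). intros y Hy.
      assert (Hy1 : Rabs y < 1).
      { change (Rabs (y - 0) < 1) in Hy. rewrite Rminus_0_r in Hy. exact Hy. }
      destruct (Req_dec y 0) as [-> | Hy0].
      * rewrite Rmult_0_l, Rabs_R0, sqrt_0. lra.
      * rewrite Rabs_mult, <- (Rabs_Rabsolu y) at 1. rewrite <- Rabs_mult.
        apply mul_ln_pow_le_sqrt. split; [apply Rabs_pos_lt, Hy0 | lra].
    + assert (H : continuous (fun y => 2 ^ m * INR (fact m) * sqrt (Rabs y)) 0).
      { apply continuous_Rmult_const_l.
        apply (continuous_comp Rabs sqrt); [apply continuous_Rabs | apply continuous_sqrt]. }
      unfold continuous in H. rewrite Rabs_R0, sqrt_0, Rmult_0_r in H. exact H.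
  - apply (continuous_mult (fun y => y) (fun y => ln (Rabs y) ^ m)).
    + apply continuous_id.
    + apply continuous_pow, continuous_ln_Rabs, Hx.
Qed.

Lemma continuous_sin (x : R) : continuous sin x.
Proof. apply continuity_pt_filterlim, continuity_sin. Qed.

Lemma continuous_cos (x : R) : continuous cos x.
Proof. apply continuity_pt_filterlim, continuity_cos. Qed.

Lemma continuous_half (x : R) : continuous (fun y => y / 2) x.
Proof. apply (continuous_mult (fun y => y) (fun _ => / 2)); [apply continuous_id | apply continuous_const]. Qed.

(** The derivative is asked for in the interior only, because the antiderivative used below involves
    a logarithm singular at 0. The difference of F and the integral of f is continuous with zero
    derivative inside, hence takes equal values at a and b. *)
Lemma is_RInt_of_is_derive_interior (F f : R -> R) (a b : R) :
  a < b -> (forall x, continuous F x) -> (forall x, continuous f x) ->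
  (forall x, a < x < b -> is_derive F x (f x)) ->
  is_RInt f a b (F b - F a).
Proof.
  intros Hab HF Hf HD.
  assert (HR : forall x, is_RInt f a x (RInt f a x)).
  { intros x. apply (RInt_correct f a x), ex_RInt_continuous. intros; apply Hf. }
  assert (HG : forall x, is_derive (fun x => RInt f a x) x (f x)).
  { intros x. apply (is_derive_RInt f _ a); [apply filter_forall, HR | apply Hf]. }
  destruct (MVT_gen (fun x => F x - RInt f a x) a b (fun _ => 0)) as [c [_ Hc]].
  - intros x Hx. rewrite Rmin_left, Rmax_right in Hx by lra.
    replace 0 with (f x - f x) by ring.
    apply (is_derive_minus F (fun x => RInt f a x) x _ _ (HD x Hx) (HG x)).
  - intros x _. apply continuity_pt_minus.
    + apply continuity_pt_filterlim, HF.
    + apply continuity_pt_filterlim.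
      apply (ex_derive_continuous (fun x => RInt f a x)). eexists; apply HG.
  - assert (H0 : RInt f a a = 0) by apply (RInt_point a f).
    replace (F b - F a) with (RInt f a b) by lra. apply HR.
Qed.

(** The inner sum of [ls_inner]. For r >= 1 and s > 0, its value at z = ln s times s^r is the
    integral of y^(r-1) (ln y)^l over [0, s]. *)
Definition log_moment (r l : nat) (z : R) : R :=
  sum_f_R0 (fun p => (-1) ^ p * falling (INR l) p * z ^ (l - p) / INR r ^ (p + 1)) l.

(** Peels off the first factor, where the definition peels off the last. *)
Lemma falling_S_S (l p : nat) :
  falling (INR (S l)) (S p) = INR (S l) * falling (INR l) p.
Proof.
  induction p as [|p IH].
  - change (1 * (INR (S l) - 0) = INR (S l) * 1). ring.
  - change (falling (INR (S l)) (S (S p))) with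
      (falling (INR (S l)) (S p) * (INR (S l) - INR (S p))).
    rewrite IH. cbn [falling]. rewrite !S_INR. ring.
Qed.

(** This is integration by parts in the moment integral, lowering the power of the logarithm by
    one. *)
Lemma log_moment_S (r l : nat) (z : R) :
  (0 < r)%nat ->
  log_moment r (S l) z = z ^ S l / INR r - INR (S l) / INR r * log_moment r l z.
Proof.
  intros Hr. assert (Hr' : INR r <> 0) by (apply not_0_INR; lia).
  unfold log_moment. rewrite decomp_sum by lia.
  unfold Rminus; f_equal.
  - simpl. field. assumption.
  - rewrite Ropp_mult_distr_l, scal_sum. simpl pred.
    apply sum_eq. intros p _. rewrite falling_S_S.
    replace (S l - S p)%nat with (l - p)%nat by lia.
    replace (S p + 1)%nat with (S (p + 1)) by lia.
    change ((-1) ^ S p) with (-1 * (-1) ^ p).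
    change (INR r ^ S (p + 1)) with (INR r * INR r ^ (p + 1)).
    field. split; [assumption | apply pow_nonzero; assumption].
Qed.

(* z = ln s turns this into (s^r V(ln s))' = s^(r-1) (ln s)^l for V = log_moment r l. *)
Lemma is_derive_log_moment (r l : nat) (z : R) :
  (0 < r)%nat -> is_derive (log_moment r l) z (z ^ l - INR r * log_moment r l z).
Proof.
  intros Hr. assert (Hr' : INR r <> 0) by (apply not_0_INR; lia).
  induction l as [|l IH].
  - unfold log_moment. simpl.
    replace (1 - _) with 0 by (field; assumption).
    apply is_derive_Reals, derivable_pt_lim_const.
  - apply (is_derive_ext (fun z => z ^ S l / INR r - INR (S l) / INR r * log_moment r l z));
      [intros t; symmetry; apply log_moment_S, Hr |].
    rewrite log_moment_S by assumption.
    apply is_derive_Reals in IH. apply is_derive_Reals.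
    replace (z ^ S l - _) with
      (INR (S l) * z ^ l / INR r
       - INR (S l) / INR r * (z ^ l - INR r * log_moment r l z)) by (field; assumption).
    apply derivable_pt_lim_minus.
    + apply derivable_pt_lim_div_scal, derivable_pt_lim_pow.
    + apply derivable_pt_lim_scal, IH.
Qed.

Lemma is_derive_sum_f_R0 (f : nat -> R -> R) (df : nat -> R) (n : nat) (x : R) :
  (forall i, is_derive (f i) x (df i)) ->
  is_derive (fun y => sum_f_R0 (fun i => f i y) n) x (sum_f_R0 df n).
Proof.
  intros H. induction n as [|n IH]; simpl; [apply H |].
  apply (is_derive_plus (fun y => sum_f_R0 (fun i => f i y) n)); [exact IH | apply H].
Qed.

Lemma continuous_sum_f_R0 (f : nat -> R -> R) (n : nat) (x : R) :
  (forall i, continuous (f i) x) -> continuous (fun y => sum_f_R0 (fun i => f i y) n) x.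
Proof.
  intros H. induction n as [|n IH]; simpl; [apply H |].
  apply (continuous_plus (fun y => sum_f_R0 (fun i => f i y) n)); [exact IH | apply H].
Qed.

Lemma ln_2_pos : 0 < ln 2.
Proof. rewrite <- ln_1. apply ln_increasing; lra. Qed.

(** With n = j - k - 1, the function is the combination of the [log_moment r l] with weights C(n, l)
    (ln 2)^(n-l), so by the binomial theorem the powers z^l assemble into (ln 2 + z)^n, which is (ln
    (2s))^n for z = ln s. *)
Lemma is_derive_ls_inner (j k r : nat) (z : R) :
  (0 < r)%nat ->
  is_derive (fun z => ln 2 ^ (j - k - 1) * ls_inner j k z r) z
    ((ln 2 + z) ^ (j - k - 1) - INR r * (ln 2 ^ (j - k - 1) * ls_inner j k z r)).
Proof.
  intros Hr. set (n := (j - k - 1)%nat).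
  pose proof ln_2_pos as Hl.
  replace (_ - _) with
    (ln 2 ^ n * sum_f_R0 (fun l => Binomial.C n l / ln 2 ^ l
                                   * (z ^ l - INR r * log_moment r l z)) n).
  - apply is_derive_scal.
    apply (is_derive_sum_f_R0 (fun l z => Binomial.C n l / ln 2 ^ l * log_moment r l z)
             (fun l => Binomial.C n l / ln 2 ^ l * (z ^ l - INR r * log_moment r l z))).
    intros l. apply is_derive_scal, is_derive_log_moment, Hr.
  - rewrite Rplus_comm, binomial. unfold ls_inner. fold n.
    rewrite <- !Rmult_assoc, !scal_sum, <- minus_sum.
    apply sum_eq. intros l Hln.
    fold (log_moment r l z).
    replace (ln 2 ^ n) with (ln 2 ^ l * ln 2 ^ (n - l))
      by (rewrite <- pow_add; f_equal; lia).
    field. apply pow_nonzero; lra.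
Qed.

(** Expanding gives a linear combination of terms y (ln |y|)^m, each continuous even at 0. *)
Lemma continuous_mul_ls_inner (j k r : nat) (x : R) :
  continuous (fun y => y * ls_inner j k (ln (Rabs y)) r) x.
Proof.
  unfold ls_inner.
  apply (continuous_ext (fun y => sum_f_R0 (fun l => Binomial.C (j - k - 1) l / ln 2 ^ l *
     sum_f_R0 (fun p => (-1) ^ p * falling (INR l) p / INR r ^ (p + 1)
       * (y * ln (Rabs y) ^ (l - p))) l) (j - k - 1))).
  - intros y. rewrite scal_sum. apply sum_eq. intros l _.
    rewrite Rmult_assoc; f_equal. rewrite Rmult_comm, scal_sum.
    apply sum_eq. intros p _. unfold Rdiv; ring.
  - apply continuous_sum_f_R0. intros l.
    apply continuous_Rmult_const_l.
    apply continuous_sum_f_R0. intros p.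
    apply continuous_Rmult_const_l.
    apply continuous_mul_ln_pow.
Qed.

(** One of the m + 1 sine factors is paired with the logarithm, as y (ln |y|)^n at y = 2 sin(x/2),
    which covers the zeros of the sine. *)
Lemma continuous_sin_pow_log (m n : nat) (x : R) :
  continuous (fun x => sin (x / 2) ^ S m * cos (x / 2) * ln (Rabs (2 * sin (x / 2))) ^ n) x.
Proof.
  set (s := fun x => sin (x / 2)).
  assert (Hs : continuous s x)
    by (apply (continuous_comp (fun x => x / 2) sin); [apply continuous_half | apply continuous_sin]).
  apply (continuous_ext (fun x => s x ^ m * cos (x / 2) * (/ 2 *
     ((2 * s x) * ln (Rabs (2 * s x)) ^ n)))).
  - intros y. unfold s. simpl. field.
  - apply (continuous_mult (fun x => s x ^ m * cos (x / 2))).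
    + apply (continuous_mult (fun x => s x ^ m)); [apply continuous_pow, Hs |].
      apply (continuous_comp (fun x => x / 2) cos); [apply continuous_half | apply continuous_cos].
    + apply continuous_Rmult_const_l.
      apply (continuous_comp (fun x => 2 * s x) (fun y => y * ln (Rabs y) ^ n)).
      * apply continuous_Rmult_const_l, Hs.
      * apply continuous_mul_ln_pow.
Qed.

Lemma sin_half_pos (x : R) : 0 < x <= PI -> 0 < sin (x / 2).
Proof. intros Hx. pose proof PI_RGT_0. apply sin_gt_0; lra. Qed.

(** An antiderivative is 2 Phi(sin(x/2)) with Phi(y) = y^r W(ln |y|). Since W' = (ln 2 + z)^n - r W,
    the terms in r W cancel and Phi'(y) = y^(r-1) (ln (2y))^n for y > 0. *)
Lemma is_RInt_sin_pow_log (j k m : nat) (theta : R) :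
  0 < theta <= PI ->
  is_RInt (fun x => sin (x / 2) ^ S m * cos (x / 2)
                    * ln (Rabs (2 * sin (x / 2))) ^ (j - k - 1)) 0 theta
    (2 * sin (theta / 2) ^ S (S m)
     * (ln 2 ^ (j - k - 1) * ls_inner j k (ln (sin (theta / 2))) (S (S m)))).
Proof.
  intros Ht. set (n := (j - k - 1)%nat). set (r := S (S m)).
  set (W := fun z => ln 2 ^ n * ls_inner j k z r).
  set (Phi := fun y => y ^ r * W (ln (Rabs y))).
  (* The lower endpoint contributes Phi(0) = 0, because r > 0. *)
  replace (2 * _ * _) with (2 * Phi (sin (theta / 2)) - 2 * Phi (sin (0 / 2))).
  2:{ unfold Rdiv at 2. rewrite Rmult_0_l, sin_0. unfold Phi.
      rewrite (pow_i r) by (unfold r; lia).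
      rewrite Rabs_pos_eq by (left; apply sin_half_pos, Ht). unfold W, r. ring. }
  apply (is_RInt_of_is_derive_interior (fun x => 2 * Phi (sin (x / 2)))).
  - lra.
  - intros x. apply continuous_Rmult_const_l.
    apply (continuous_comp (fun x => sin (x / 2)) Phi).
    + apply (continuous_comp (fun x => x / 2) sin); [apply continuous_half | apply continuous_sin].
    + apply (continuous_ext (fun y => y ^ S m * ln 2 ^ n
               * (y * ls_inner j k (ln (Rabs y)) r))).
      * intros y. unfold Phi, W, r. simpl. ring.
      * apply (continuous_mult (fun y => y ^ S m * ln 2 ^ n));
          [| apply continuous_mul_ls_inner].
        apply (continuous_mult (fun y => y ^ S m)); [| apply continuous_const].
        apply continuous_pow, continuous_id.
  - intros x. apply continuous_sin_pow_log.
  - intros x Hx.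
    assert (Hs : 0 < sin (x / 2)) by (apply sin_half_pos; lra).
    assert (HPhi : is_derive Phi (sin (x / 2))
              (sin (x / 2) ^ S m * (ln 2 + ln (sin (x / 2))) ^ n)).
    { revert Hs. generalize (sin (x / 2)). intros y Hy.
      assert (HW : is_derive (fun y => W (ln (Rabs y))) y
                 (/ y * ((ln 2 + ln (Rabs y)) ^ n - INR r * W (ln (Rabs y))))).
      { apply (is_derive_comp W (fun y => ln (Rabs y))).
        - apply is_derive_ls_inner. unfold r; lia.
        - apply is_derive_ln_Rabs, Hy. }
      rewrite (Rabs_pos_eq y) in HW by lra.
      apply is_derive_Reals in HW.
      assert (H := derivable_pt_lim_mult _ _ _ _ _ (derivable_pt_lim_pow y r) HW).
      apply is_derive_Reals in H.
      refine (eq_rect _ (is_derive Phi y) H _ _).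
      rewrite (Rabs_pos_eq y) by lra. unfold r. simpl pred. simpl pow.
      match goal with |- ?a = ?b => change (@eq R a b) end.
      field. lra. }
    assert (Hsin : is_derive (fun x => sin (x / 2)) x (/ 2 * cos (x / 2))).
    { apply (is_derive_comp sin (fun x => x / 2)).
      - apply is_derive_Reals, derivable_pt_lim_sin.
      - auto_derive; [trivial | field]. }
    assert (H := is_derive_scal _ _ 2 _ (is_derive_comp Phi (fun x => sin (x / 2)) _ _ _ HPhi Hsin)).
    refine (eq_rect _ (is_derive _ x) H _ _).
    rewrite Rabs_pos_eq, ln_mult by lra.
    unfold scal; simpl; unfold mult; simpl.
    match goal with |- ?a = ?b => change (@eq R a b) end. field.
Qed.

Lemma continuous_pow_log_sin (k n : nat) (x : R) :
  (1 <= k)%nat -> 0 <= x <= PI ->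
  continuous (fun x => x ^ k * ln (Rabs (2 * sin (x / 2))) ^ n) x.
Proof.
  intros Hk Hx. destruct k as [|k]; [lia |].
  set (s := fun x => 2 * sin (x / 2)).
  assert (Hs : forall x, continuous s x).
  { intros y. apply continuous_Rmult_const_l.
    apply (continuous_comp (fun x => x / 2) sin); [apply continuous_half | apply continuous_sin]. }
  apply (continuous_ext (fun x => x ^ k * (x * ln (Rabs (s x)) ^ n))).
  { intros y. unfold s. simpl. ring. }
  apply (continuous_mult (fun x => x ^ k)); [apply continuous_pow, continuous_id |].
  destruct (Req_dec x 0) as [-> | Hx0].
  - unfold continuous. rewrite Rmult_0_l.
    apply (filterlim_of_Rabs_le _ _ (fun y => 2 * Rabs (s y * ln (Rabs (s y)) ^ n))).
    + assert (Hsinc := is_lim_sinc_0). apply is_lim_spec in Hsinc.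
      (* Near 0 the quotient sin u / u exceeds 1/2, so |y| <= 2 |[s y]| and the factor y can be
         traded for [s y]. *)
      destruct (Hsinc (mkposreal (/ 2) ltac:(lra))) as [d Hd]. simpl in Hd.
      exists d. intros y Hy. change (Rabs (y - 0) < d) in Hy. rewrite Rminus_0_r in Hy.
      rewrite !Rabs_mult, <- Rmult_assoc.
      apply Rmult_le_compat_r; [apply Rabs_pos |].
      destruct (Req_dec y 0) as [-> | Hy0].
      * rewrite Rabs_R0. pose proof (Rabs_pos (s 0)). lra.
      * assert (H2 : y / 2 <> 0) by lra.
        specialize (Hd (y / 2)).
        assert (H3 : Rabs (sin (y / 2) / (y / 2) - 1) < / 2).
        { apply Hd; [| exact H2]. change (Rabs (y / 2 - 0) < d).
          rewrite Rminus_0_r. unfold Rdiv. rewrite Rabs_mult, (Rabs_pos_eq (/ 2)) by lra.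
          pose proof (Rabs_pos y). lra. }
        apply Rabs_def2 in H3.
        replace (s y) with (sin (y / 2) / (y / 2) * y) by (unfold s; field; assumption).
        rewrite Rabs_mult, (Rabs_pos_eq (_ / _)) by lra.
        pose proof (Rabs_pos y). nra.
    + assert (H : continuous (fun y => 2 * Rabs (s y * ln (Rabs (s y)) ^ n)) 0).
      { apply continuous_Rmult_const_l.
        apply (continuous_comp (fun y => s y * ln (Rabs (s y)) ^ n) Rabs);
          [| apply continuous_Rabs].
        apply (continuous_comp s (fun y => y * ln (Rabs y) ^ n));
          [apply Hs | apply continuous_mul_ln_pow]. }
      assert (H0 : s 0 = 0) by (unfold s, Rdiv; rewrite Rmult_0_l, sin_0; ring).
      unfold continuous in H. rewrite H0, Rmult_0_l, Rabs_R0, Rmult_0_r in H. exact H.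
  - apply (continuous_mult (fun x => x) (fun x => ln (Rabs (s x)) ^ n)); [apply continuous_id |].
    apply continuous_pow. apply (continuous_comp s (fun y => ln (Rabs y))); [apply Hs |].
    apply continuous_ln_Rabs. unfold s. pose proof (sin_half_pos x). lra.
Qed.

(** * Termwise integration *)

(** The integral is split at b - d: the first piece is eventually uniformly small, and the bound K
    controls the short piece next to b, where uniform convergence may fail. *)
Lemma is_lim_seq_RInt_0 (g : nat -> R -> R) (b K : R) :
  0 < b -> (forall n, ex_RInt (g n) 0 b) ->
  (forall n x, 0 <= x <= b -> Rabs (g n x) <= K) ->
  (forall c eps, 0 < c < b -> 0 < eps ->
     eventually (fun n => forall x, 0 <= x <= c -> Rabs (g n x) <= eps)) ->
  is_lim_seq (fun n => RInt (g n) 0 b) 0.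
Proof.
  intros Hb Hex HK Hsmall. apply is_lim_seq_spec. intros eps.
  pose proof (cond_pos eps) as Heps.
  assert (HK0 : 0 <= K).
  { apply Rle_trans with (2 := HK O 0 ltac:(lra)). apply Rabs_pos. }
  (* Each piece will contribute at most eps / 4; K + 1 keeps the denominator positive when K = 0. *)
  set (d := Rmin (b / 2) (eps / (4 * (K + 1)))).
  assert (Hd : 0 < d).
  { apply Rmin_glb_lt; [lra | apply Rdiv_lt_0_compat; lra]. }
  assert (Hd1 : d <= b / 2) by apply Rmin_l.
  assert (Hd2 : d * K <= eps / 4).
  { assert (H : d <= eps / (4 * (K + 1))) by apply Rmin_r.
    apply Rle_div_r in H; [nra | lra]. }
  destruct (Hsmall (b - d) (eps / (4 * b)) ltac:(lra) ltac:(apply Rdiv_lt_0_compat; lra))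
    as [N HN].
  exists N. intros n Hn. rewrite Rminus_0_r.
  assert (H1 : ex_RInt (g n) 0 (b - d)) by (apply (@ex_RInt_Chasles_1 R_CompleteNormedModule _ _ _ b); [lra | apply Hex]).
  assert (H2 : ex_RInt (g n) (b - d) b) by (apply (@ex_RInt_Chasles_2 R_CompleteNormedModule _ 0); [lra | apply Hex]).
  rewrite <- (RInt_Chasles (g n) _ _ _ H1 H2).
  apply Rle_lt_trans with (1 := Rabs_triang _ _).
  assert (B1 := abs_RInt_le_const (g n) 0 (b - d) (eps / (4 * b)) ltac:(lra) H1 (HN n Hn)).
  assert (B2 := abs_RInt_le_const (g n) (b - d) b K ltac:(lra) H2
    (fun t Ht => HK n t ltac:(lra))).
  assert (B3 : (b - d - 0) * (eps / (4 * b)) <= eps / 4).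
  { apply Rle_trans with (b * (eps / (4 * b))); [| right; field; lra].
    apply Rmult_le_compat_r; [apply Rdiv_le_0_compat; lra | lra]. }
  replace (b - (b - d)) with d in B2 by ring. lra.
Qed.

Lemma continuous_bounded (f : R -> R) (a b : R) :
  a <= b -> (forall x, a <= x <= b -> continuous f x) ->
  exists K, forall x, a <= x <= b -> Rabs (f x) <= K.
Proof.
  intros Hab Hf.
  destruct (continuity_ab_maj (fun x => Rabs (f x)) a b Hab) as [c [Hc _]].
  - intros x Hx. apply continuity_pt_filterlim.
    apply (continuous_comp f Rabs); [apply Hf, Hx | apply continuous_Rabs].
  - exists (Rabs (f c)). exact Hc.
Qed.

(** Coefficients of index below k or of parity opposite to k vanish. *)
Lemma sum_arcsin_coef_parity (k q : nat) (t : R) :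
  sum_f_R0 (fun n => arcsin_coef k n * t ^ n) (k + 2 * q)
  = sum_f_R0 (fun i => arcsin_coef k (k + 2 * i) * t ^ (k + 2 * i)) q.
Proof.
  induction q as [|q IH].
  - rewrite Nat.add_0_r. simpl sum_f_R0 at 2. rewrite Nat.add_0_r.
    destruct k as [|k]; [reflexivity |]. rewrite tech5.
    rewrite (sum_eq _ (fun _ => 0)).
    + rewrite sum_cte. ring.
    + intros i Hi. rewrite arcsin_coef_lt by lia. ring.
  - rewrite tech5, <- IH.
    replace (k + 2 * S q)%nat with (S (S (k + 2 * q))) by lia.
    rewrite !tech5, (arcsin_coef_odd (S (k + 2 * q)) k q) by lia. ring.
Qed.

(** This leading coefficient yields the q = 0 term, which the theorem states separately. *)
Lemma arcsin_coef_diag (k : nat) : arcsin_coef k k = / INR (fact k).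
Proof.
  induction k as [| |k IH] using nat_ind_2step; [simpl; field | simpl; field |].
  rewrite arcsin_coef_SS, IH, arcsin_coef_lt, !fact_simpl, !mult_INR by lia.
  field. repeat split; [apply INR_fact_neq_0 | |]; apply not_0_INR; lia.
Qed.

Lemma sin_half_bounds (x : R) : 0 <= x < PI -> 0 <= sin (x / 2) < 1.
Proof.
  intros Hx. split.
  - apply sin_ge_0; lra.
  - apply Rabs_def2, Rabs_sin_lt_1. lra.
Qed.

(** Truncation of the expansion of x^k given by [cos_mul_arcsin_series] at x / 2. *)
Definition pow_partial_sum (k M : nat) (x : R) : R :=
  2 ^ k * INR (fact k)
  * (cos (x / 2) * sum_f_R0 (fun n => arcsin_coef k n * sin (x / 2) ^ n) M).

Lemma pow_partial_sum_tail (k M : nat) (x : R) :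
  0 <= x < PI ->
  x ^ k - pow_partial_sum k M x
  <= 2 ^ k * INR (fact k) * (sin (x / 2) ^ S M / (1 - sin (x / 2)))
  /\ 0 <= x ^ k - pow_partial_sum k M x.
Proof.
  intros Hx. pose proof PI_RGT_0. pose proof (sin_half_bounds x Hx) as Hs.
  assert (Hf : 0 < 2 ^ k * INR (fact k)).
  { apply Rmult_lt_0_compat; [apply pow_lt; lra | apply INR_fact_lt_0]. }
  assert (Hc : 0 <= cos (x / 2) <= 1) by (split; [apply cos_ge_0; lra | apply COS_bound]).
  assert (Hxk : x ^ k = 2 ^ k * INR (fact k)
             * (cos (x / 2) * PSeries (arcsin_coef k) (sin (x / 2)))).
  { rewrite cos_mul_arcsin_series by lra.
    replace x with (2 * (x / 2)) at 1 by field. rewrite Rpow_mult_distr.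
    field. apply INR_fact_neq_0. }
  assert (Ht := PSeries_tail_bounds (arcsin_coef k) (sin (x / 2)) M
                  (fun n => arcsin_coef_bounds n k) Hs).
  unfold pow_partial_sum. rewrite Hxk, <- Rmult_minus_distr_l, <- Rmult_minus_distr_l.
  revert Ht. generalize (PSeries (arcsin_coef k) (sin (x / 2))
    - sum_f_R0 (fun n => arcsin_coef k n * sin (x / 2) ^ n) M).
  intros u Hu. split.
  - apply Rmult_le_compat_l; [lra |]. nra.
  - apply Rmult_le_pos; [lra |]. nra.
Qed.

(** A bound uniform in M that includes x = PI: there cos(x/2) = 0, so the partial sum is 0 and the
    remainder is PI^k itself. *)
Lemma pow_partial_sum_le (k M : nat) (x : R) :
  0 <= x <= PI -> 0 <= x ^ k - pow_partial_sum k M x <= x ^ k.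
Proof.
  intros Hx. pose proof PI_RGT_0.
  assert (Hp : 0 <= pow_partial_sum k M x).
  { unfold pow_partial_sum.
    apply Rmult_le_pos; [apply Rmult_le_pos; [apply pow_le; lra | apply pos_INR] |].
    apply Rmult_le_pos; [apply cos_ge_0; lra |].
    apply cond_pos_sum. intros n. apply Rmult_le_pos; [apply arcsin_coef_bounds |].
    apply pow_le, sin_ge_0; lra. }
  split; [| lra].
  destruct (Rle_lt_or_eq_dec x PI (proj2 Hx)) as [Hlt | ->].
  - apply pow_partial_sum_tail. lra.
  - unfold pow_partial_sum. rewrite cos_PI2.
    pose proof (pow_le PI k). lra.
Qed.

(** * Integrals of the partial sums and of the remainders *)

Lemma is_RInt_sum_f_R0 (f : nat -> R -> R) (I : nat -> R) (a b : R) (n : nat) :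
  (forall i, is_RInt (f i) a b (I i)) ->
  is_RInt (fun x => sum_f_R0 (fun i => f i x) n) a b (sum_f_R0 I n).
Proof.
  intros H. induction n as [|n IH]; simpl; [apply H |].
  apply (is_RInt_plus (fun x => sum_f_R0 (fun i => f i x) n)); [exact IH | apply H].
Qed.

(** The factorials cancel, and (-1/4)^q 4^q (-1)^(q+1) = -1. *)
Lemma ls_term_arcsin_coef (j k q : nat) (s : R) :
  ls_term j k s q =
  - (arcsin_coef k (k + 2 * q) * s ^ (2 * q) * ls_inner j k (ln s) (k + 2 * q + 1)).
Proof.
  unfold ls_term. rewrite Qf_arcsin_coef, Rpow_mult_distr, (pow_mult 2).
  assert (H : (- / 4) ^ q * (2 ^ 2) ^ q * (-1) ^ (q + 1) = - 1).
  { rewrite pow_add, <- Rmult_assoc, <- !Rpow_mult_distr.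
    replace (- / 4 * 2 ^ 2 * -1) with 1 by field. rewrite pow1. ring. }
  set (A := arcsin_coef k (k + 2 * q)). set (B := ls_inner j k (ln s) (k + 2 * q + 1)).
  transitivity ((- / 4) ^ q * (2 ^ 2) ^ q * (-1) ^ (q + 1) * (A * s ^ (2 * q) * B)).
  - field. apply INR_fact_neq_0.
  - rewrite H. ring.
Qed.

Lemma is_RInt_pow_partial_sum_log (j k q : nat) (theta : R) :
  (1 <= k)%nat -> 0 < theta <= PI ->
  is_RInt (fun x => pow_partial_sum k (k + 2 * q) x
                    * ln (Rabs (2 * sin (x / 2))) ^ (j - k - 1)) 0 theta
    (- (2 ^ S k * INR (fact k) * sin (theta / 2) ^ S k * ln 2 ^ (j - k - 1))
     * sum_f_R0 (ls_term j k (sin (theta / 2))) q).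
Proof.
  intros Hk Ht. set (n := (j - k - 1)%nat). set (s := sin (theta / 2)).
  set (I := fun i => 2 ^ k * INR (fact k) * arcsin_coef k (k + 2 * i)
    * (2 * s ^ S (k + 2 * i) * (ln 2 ^ n * ls_inner j k (ln s) (S (k + 2 * i))))).
  replace (_ * sum_f_R0 _ q) with (sum_f_R0 I q).
  2:{ rewrite scal_sum. apply sum_eq. intros i _.
      rewrite ls_term_arcsin_coef. unfold I.
      replace (k + 2 * i + 1)%nat with (S (k + 2 * i)) by lia.
      replace (s ^ S (k + 2 * i)) with (s ^ S k * s ^ (2 * i))
        by (rewrite <- pow_add; f_equal).
      change (2 ^ S k) with (2 * 2 ^ k). ring. }
  apply (is_RInt_ext (fun x => sum_f_R0 (fun i =>
     2 ^ k * INR (fact k) * arcsin_coef k (k + 2 * i)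
     * (sin (x / 2) ^ (k + 2 * i) * cos (x / 2) * ln (Rabs (2 * sin (x / 2))) ^ n)) q)).
  - intros x _. unfold pow_partial_sum. rewrite sum_arcsin_coef_parity.
    rewrite scal_sum, scal_sum, (Rmult_comm _ (_ ^ n)), scal_sum.
    apply sum_eq. intros i _. ring.
  - apply is_RInt_sum_f_R0. intros i. unfold I.
    apply (is_RInt_scal (fun x => sin (x / 2) ^ (k + 2 * i) * cos (x / 2)
       * ln (Rabs (2 * sin (x / 2))) ^ n)).
    (* Since k >= 1, the sine always occurs to a positive power. *)
    replace (k + 2 * i)%nat with (S (k - 1 + 2 * i)) by lia.
    apply is_RInt_sin_pow_log, Ht.
Qed.

(** The integrands are bounded by |x^k (ln |2 sin(x/2)|)^n|, and on [0, c] with c < theta they decay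
    at least like rho^q for rho = sin(c/2) < 1, as [is_lim_seq_RInt_0] requires. *)
Lemma is_lim_seq_RInt_remainder (k n : nat) (theta : R) :
  (1 <= k)%nat -> 0 < theta <= PI ->
  (forall q, ex_RInt (fun x => (x ^ k - pow_partial_sum k (k + 2 * q) x)
                    * ln (Rabs (2 * sin (x / 2))) ^ n) 0 theta) ->
  is_lim_seq (fun q => RInt (fun x => (x ^ k - pow_partial_sum k (k + 2 * q) x)
                    * ln (Rabs (2 * sin (x / 2))) ^ n) 0 theta) 0.
Proof.
  intros Hk Ht Hex. pose proof PI_RGT_0.
  destruct (continuous_bounded (fun x => x ^ k * ln (Rabs (2 * sin (x / 2))) ^ n) 0 theta)
    as [K HK]; [lra | intros x Hx; apply continuous_pow_log_sin; [assumption | lra] |].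
  destruct (continuous_bounded (fun y => y * ln (Rabs y) ^ n) 0 2)
    as [K2 HK2]; [lra | intros x _; apply continuous_mul_ln_pow |].
  apply (is_lim_seq_RInt_0 (fun q x => (x ^ k - pow_partial_sum k (k + 2 * q) x)
                    * ln (Rabs (2 * sin (x / 2))) ^ n) theta K); [lra | exact Hex | |].
  - intros q x Hx. apply Rle_trans with (2 := HK x Hx).
    rewrite !Rabs_mult. apply Rmult_le_compat_r; [apply Rabs_pos |].
    assert (Hb := pow_partial_sum_le k (k + 2 * q) x ltac:(lra)).
    rewrite !Rabs_pos_eq; lra.
  - intros c eps Hc Heps.
    set (rho := sin (c / 2)).
    assert (Hrho : 0 <= rho < 1) by (apply sin_half_bounds; lra).
    set (A := 2 ^ k * INR (fact k)).
    assert (HA : 0 < A).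
    { apply Rmult_lt_0_compat; [apply pow_lt; lra | apply INR_fact_lt_0]. }
    assert (Hlim : is_lim_seq (fun q => A * K2 / (1 - rho) * rho ^ q) 0).
    { rewrite <- (Rmult_0_r (A * K2 / (1 - rho))).
      apply (is_lim_seq_scal_l _ _ (Finite 0)), is_lim_seq_geom.
      rewrite Rabs_pos_eq; lra. }
    apply is_lim_seq_spec in Hlim.
    apply filter_imp with (2 := Hlim (mkposreal eps Heps)).
    intros q Hq x Hx. simpl in Hq. rewrite Rminus_0_r in Hq.
    apply Rabs_def2 in Hq.
    assert (Hs := sin_half_bounds x ltac:(lra)).
    assert (Hsr : sin (x / 2) <= rho) by (apply sin_incr_1; lra).
    destruct (pow_partial_sum_tail k (k + 2 * q) x ltac:(lra)) as [Htail Hpos].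
    fold A in Htail.
    set (s := sin (x / 2)) in *. set (L := ln (Rabs (2 * s)) ^ n) in *.
    (* One sine factor of the tail s^(k+2q+1) is reserved to absorb the logarithm, through the bound
       [K2] at y = 2s. *)
    assert (HL : s * Rabs L <= K2).
    { assert (H1 := HK2 (2 * s) ltac:(lra)). rewrite Rabs_mult in H1. fold L in H1.
      rewrite Rabs_pos_eq in H1 by lra. pose proof (Rabs_pos L). nra. }
    assert (Hpow : s ^ (k + 2 * q) <= rho ^ q).
    { apply Rle_trans with (rho ^ (k + 2 * q)); [apply pow_incr; lra |].
      replace (k + 2 * q)%nat with (q + (k + q))%nat by lia.
      rewrite pow_add. pose proof (pow_le rho q (proj1 Hrho)).
      assert (rho ^ (k + q) <= 1)
        by (rewrite <- (pow1 (k + q)); apply pow_incr; lra).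
      nra. }
    assert (Hinv : 0 < / (1 - s) <= / (1 - rho)).
    { split; [apply Rinv_0_lt_compat; lra | apply Rinv_le_contravar; lra]. }
    rewrite Rabs_mult, (Rabs_pos_eq (_ - _)) by assumption.
    apply Rle_trans with (A * (s ^ S (k + 2 * q) / (1 - s)) * Rabs L).
    { apply Rmult_le_compat_r; [apply Rabs_pos | assumption]. }
    apply Rle_trans with (A * K2 / (1 - rho) * rho ^ q); [| lra].
    replace (A * (s ^ S (k + 2 * q) / (1 - s)) * Rabs L)
      with (A * ((s * Rabs L) * (/ (1 - s) * s ^ (k + 2 * q))))
      by (simpl; field; lra).
    replace (A * K2 / (1 - rho) * rho ^ q)
      with (A * (K2 * (/ (1 - rho) * rho ^ q))) by (field; lra).
    apply Rmult_le_compat_l; [lra |].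
    assert (0 <= s ^ (k + 2 * q)) by (apply pow_le; lra).
    apply Rmult_le_compat; [| | exact HL |].
    + apply Rmult_le_pos; [lra | apply Rabs_pos].
    + apply Rmult_le_pos; lra.
    + apply Rmult_le_compat; lra.
Qed.

(** The integral of the remainder equals -Ls plus D times the partial sum over q, counted from q =
    0. It tends to 0, so dividing by D > 0 gives the limit. *)
Lemma is_series_ls_term (k j : nat) (theta : R) :
  (1 <= k)%nat -> 0 < theta <= PI ->
  is_series (ls_term j k (sin (theta / 2)))
    (Ls j k theta / (2 ^ S k * INR (fact k) * sin (theta / 2) ^ S k * ln 2 ^ (j - k - 1))).
Proof.
  intros Hk Ht. set (n := (j - k - 1)%nat).
  set (D := 2 ^ S k * INR (fact k) * sin (theta / 2) ^ S k * ln 2 ^ n).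
  assert (HD : 0 < D).
  { unfold D. apply Rmult_lt_0_compat; [apply Rmult_lt_0_compat; [apply Rmult_lt_0_compat |] |].
    - apply pow_lt; lra.
    - apply INR_fact_lt_0.
    - apply pow_lt, sin_half_pos, Ht.
    - apply pow_lt, ln_2_pos. }
  assert (HI : is_RInt (fun x => x ^ k * ln (Rabs (2 * sin (x / 2))) ^ n) 0 theta
                 (- Ls j k theta)).
  { unfold Ls. rewrite Ropp_involutive. fold n.
    apply (RInt_correct (fun x => x ^ k * ln (Rabs (2 * sin (x / 2))) ^ n)).
    apply (ex_RInt_continuous (fun x => x ^ k * ln (Rabs (2 * sin (x / 2))) ^ n)).
    intros x Hx. rewrite Rmin_left, Rmax_right in Hx by lra.
    apply continuous_pow_log_sin; [assumption | lra]. }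
  assert (HR : forall q, is_RInt (fun x => (x ^ k - pow_partial_sum k (k + 2 * q) x)
                    * ln (Rabs (2 * sin (x / 2))) ^ n) 0 theta
                 (- Ls j k theta + D * sum_f_R0 (ls_term j k (sin (theta / 2))) q)).
  { intros q.
    assert (H := is_RInt_minus _ _ _ _ _ _ HI (is_RInt_pow_partial_sum_log j k q theta Hk Ht)).
    fold n D in H.
    match type of H with is_RInt _ _ _ ?l => replace (_ + _) with l end.
    - apply is_RInt_ext with (2 := H). intros x _.
      unfold minus, plus, opp; simpl. ring.
    - unfold minus, plus, opp; simpl. ring. }
  assert (Hlim := is_lim_seq_RInt_remainder k n theta Hk Ht (fun q => ex_intro _ _ (HR q))).
  change (is_lim_seq (sum_n (ls_term j k (sin (theta / 2)))) (Ls j k theta / D)).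
  apply (is_lim_seq_ext (fun q => / D * RInt (fun x => (x ^ k - pow_partial_sum k (k + 2 * q) x)
                    * ln (Rabs (2 * sin (x / 2))) ^ n) 0 theta + Ls j k theta / D)).
  - intros q. rewrite (is_RInt_unique _ _ _ _ (HR q)), sum_n_Reals. field. lra.
  - replace (Finite (Ls j k theta / D)) with (Finite (/ D * 0 + Ls j k theta / D))
      by (f_equal; ring).
    apply is_lim_seq_plus'; [| apply is_lim_seq_const].
    apply (is_lim_seq_scal_l _ _ (Finite 0)), Hlim.
Qed.

(* The series over q >= 1 is written as a Coquelicot series in n with q = n + 1. *)
Theorem theorem4p1 (k j : nat) (theta : R) :
  (1 <= k)%nat -> (k + 1 <= j)%nat -> 0 < theta <= PI ->
  ex_series (fun n => ls_term j k (sin (theta / 2)) (S n)) /\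
  Ls j k theta =
    (ln 2) ^ j * (2 * sin (theta / 2) / ln 2) ^ (k + 1) *
    (INR (fact k) * Series (fun n => ls_term j k (sin (theta / 2)) (S n))
     - ls_inner j k (ln (sin (theta / 2))) (k + 1)).
Proof.
  intros Hk Hj Ht.
  assert (HS := is_series_ls_term k j theta Hk Ht).
  assert (Hs := sin_half_pos theta Ht). pose proof ln_2_pos as Hl.
  set (s := sin (theta / 2)) in *.
  assert (Hex : ex_series (ls_term j k s)) by (eexists; exact HS).
  split; [apply (ex_series_incr_1 (ls_term j k s)), Hex |].
  apply is_series_unique in HS. rewrite (Series_incr_1 _ Hex) in HS.
  assert (Hf := INR_fact_neq_0 k).
  (* The q = 0 term becomes, after multiplication by k!, the second sum of the theorem. *)
  assert (H0 : ls_term j k s 0 = - (ls_inner j k (ln s) (k + 1) / INR (fact k))).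
  { rewrite ls_term_arcsin_coef, Nat.mul_0_r, Nat.add_0_r, arcsin_coef_diag.
    simpl. field. assumption. }
  rewrite H0 in HS.
  set (D := 2 ^ S k * INR (fact k) * s ^ S k * ln 2 ^ (j - k - 1)) in HS.
  assert (HD : D <> 0).
  { unfold D. repeat apply Rmult_integral_contrapositive_currified;
      try apply pow_nonzero; lra. }
  replace (Ls j k theta) with (D * (Ls j k theta / D)) by (field; assumption).
  rewrite <- HS. unfold D.
  (* The hypothesis k + 1 <= j makes the natural subtraction exact. *)
  replace (ln 2 ^ j) with (ln 2 ^ (j - k - 1) * ln 2 ^ S k)
    by (rewrite <- pow_add; f_equal; lia).
  replace ((2 * s / ln 2) ^ (k + 1)) with (2 ^ S k * s ^ S k / ln 2 ^ S k).
  2:{ rewrite Nat.add_1_r. unfold Rdiv. rewrite !Rpow_mult_distr, pow_inv. reflexivity. }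
  field. split; [apply pow_nonzero; lra | assumption].
Qed.
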